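(* Let $G$ be an étale groupoid with unit space $X$. Then $(\mathcal I(G),\rho_G)$ is a complete inverse semigroup over $X$. Conversely, any complete inverse semigroup over $X$ arises in this way from an étale groupoid with unit space $X$: if $(S,\rho)$ is a complete inverse semigroup over a topological space $X$, then there are an étale groupoid $G$ with unit space $X$ and an isomorphism of semigroups $\varphi:S\to\mathcal I(G)$ such that $\rho_G\circ\varphi=\rho$.
   Context: An inverse semigroup is a semigroup in which every element $s$ has a unique inverse $s^*$ ($ss^*s=s$, $s^*ss^*=s^*$); $E(S)$ is its set of idempotents. Natural order: $s\le t$ iff $s=ft$ for some $f\in E(S)$. Elements $s,t$ are compatible if $st^*$ and $s^*t$ are idempotents; a subset is compatible if any two of its elements are. $S$ is complete if every compatible subset has a join (least upper bound) in the natural order. For a topological space $X$, $\mathcal I(X)$ is the inverse semigroup of all homeomorphisms between open subsets of $X$, with product $hh'$ defined on $h^{-1}(\mathrm{cod}(h)\cap\mathrm{dom}(h'))$ by $(hh')(x)=h'(h(x))$ (first $h$, then $h'$). A representation $\rho:S\to\mathcal I(X)$ is a semigroup homomorphism; it is full if it restricts to an isomorphism $E(S)\to E(\mathcal I(X))\cong\Omega(X)$ (the topology of $X$). A complete inverse semigroup over $X$ is a pair $(S,\rho)$ with $S$ a complete inverse semigroup and $\rho:S\to\mathcal I(X)$ a full representation. A topological groupoid $G$ has spaces $G_1$ (arrows), $G_0$ (objects, or units) and continuous maps $d,r:G_1\to G_0$, $u:G_0\to G_1$, $i:G_1\to G_1$, and multiplication $xy$ defined when $r(x)=d(y)$, satisfying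 the usual groupoid axioms; it is étale if $d$ is a local homeomorphism. A local bisection of $G$ is identified with an open set $V\subset G_1$ on which $d$ and $r$ are injective. $\mathcal I(G)$ is the inverse semigroup of local bisections under pointwise multiplication and inverse, and $\rho_G:\mathcal I(G)\to\mathcal I(G_0)$ sends $V$ to the homeomorphism $d(V)\to r(V)$, $d(x)\mapsto r(x)$ ($x\in V$). *)

(* Defs.v *)
From HB Require Import structures.
From mathcomp Require Import all_boot monoid.
From mathcomp Require Import boolp classical_sets functions topology.

Set Implicit Arguments.
Unset Strict Implicit.
Unset Printing Implicit Defensive.

Local Open Scope classical_set_scope.
Local Open Scope group_scope.

Section InverseSemigroups.
Variable S : semigroupType.
Implicit Types (s t e f : S) (A : set S).

Definition is_inverse s t := s * t * s = s /\ t * s * t = t.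

Definition inverse_semigroup := forall s, exists! t, is_inverse s t.

(* [star s] is the inverse of [s] whenever it exists and is unique;
   it is only meant to be used when [inverse_semigroup] holds. *)
Definition star s : S := xget s [set t | is_inverse s t].

Definition idempotents : set S := [set e | e * e = e].

Definition natural_le s t := exists2 f, idempotents f & s = f * t.

Definition compatible s t :=
  idempotents (s * star t) /\ idempotents (star s * t).

Definition compatible_set A := forall s t, A s -> A t -> compatible s t.

Definition is_join A s :=
  (forall a, A a -> natural_le a s) /\
  (forall t, (forall a, A a -> natural_le a t) -> natural_le s t).

Definition complete_inverse_semigroup :=
  inverse_semigroup /\
  forall A, compatible_set A -> exists s, is_join A s.

End InverseSemigroups.

(* The inverse [g] is a total function used only on [B], so this is the usual
   notion as soon as [T] is inhabited or [U] is empty. Below it is used only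
   with [T = U] or with [A] nonempty. *)
Definition homeomorphism_on (T U : topologicalType) (A : set T) (B : set U)
    (f : T -> U) :=
  exists g : U -> T,
    [/\ set_fun A B f /\ set_fun B A g,
        {in A, cancel f g}, {in B, cancel g f},
        {within A, continuous f} & {within B, continuous g}].

Definition local_homeomorphism (T U : topologicalType) (f : T -> U) :=
  forall x, exists A : set T,
    [/\ open A, A x, open (f @` A) & homeomorphism_on A (f @` A) f].

(* A partial map is represented by its graph, so that partial maps with the
   same domain and the same values are equal. *)
Definition is_phomeo (X : topologicalType) (h : set (X * X)) :=
  exists A B f, [/\ open A, open B, homeomorphism_on A B f &
                    h = [set (x, f x) | x in A]].

Record phomeo (X : topologicalType) := PHomeo {
  graph : set (X * X);
  graphP : is_phomeo graph
}.

Lemma phomeo_eq (X : topologicalType) (h k : phomeo X) :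
  graph h = graph k -> h = k.
Proof.
case: h k => [h hP] [k kP] /= hk.
by case: _ / hk in kP *; congr PHomeo; apply: Prop_irrelevance.
Qed.

Lemma is_phomeo_comp (X : topologicalType) (h k : set (X * X)) :
  is_phomeo h -> is_phomeo k ->
  is_phomeo [set p | exists2 y, h (p.1, y) & k (y, p.2)].
Proof.
move=> [A [B [f [oA oB [f' [[fAB fBA] fK f'K cf cf']] ->]]]].
move=> [C [D [g [oC oD [g' [[gCD gDC] gK g'K cg cg']] ->]]]].
have oAC : open (A `&` f @^-1` C).
  by rewrite continuous_open_subspace// in cf; move/continuous_inP: cf; apply.
have oDB : open (D `&` g' @^-1` B).
  by rewrite continuous_open_subspace// in cg'; move/continuous_inP: cg'; apply.
exists (A `&` f @^-1` C), (D `&` g' @^-1` B), (g \o f); split=> //.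
- exists (f' \o g'); split.
  + split=> x [/= a b]; split=> /=; first exact: gCD.
    * by rewrite gK ?inE//; exact: fAB.
    * exact: fBA.
    * by rewrite f'K ?inE//; exact: gDC.
  + by move=> x /[!inE] -[/= a b]; rewrite gK ?inE// fK ?inE.
  + by move=> x /[!inE] -[/= a b]; rewrite f'K ?inE// g'K ?inE.
  + rewrite continuous_open_subspace// in cf; rewrite continuous_open_subspace// in cg.
    apply: continuous_in_subspaceT => x /[!inE] -[/= a b].
    by apply: continuous_comp; [apply: cf|apply: cg]; rewrite inE.
  + rewrite continuous_open_subspace// in cf'; rewrite continuous_open_subspace// in cg'.
    apply: continuous_in_subspaceT => x /[!inE] -[/= a b].
    by apply: continuous_comp; [apply: cg'|apply: cf']; rewrite inE.
- apply/seteqP; split=> [[x z] /= [y [a Aa [<- <-]] [c Cc [cE <-]]]|].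
    by exists a; [split=> //=; rewrite -cE|rewrite /= cE].
  move=> _ /= [x [Ax Cfx] <-] /=; exists (f x); first by exists x.
  by exists (f x).
Qed.

Section PartialHomeomorphisms.
Variable X : topologicalType.

HB.instance Definition _ := gen_eqMixin (phomeo X).
HB.instance Definition _ := gen_choiceMixin (phomeo X).

(* Products are in diagrammatic order: first [h], then [k]. *)
Definition phomeo_mul (h k : phomeo X) : phomeo X :=
  PHomeo (is_phomeo_comp (graphP h) (graphP k)).

Lemma phomeo_mulA : associative phomeo_mul.
Proof.
move=> h k l; apply: phomeo_eq; apply/seteqP; split=> -[x w] /=.
  by move=> [y hxy [z kyz lzw]]; exists z => //; exists y.
by move=> [z [y hxy kyz] lzw]; exists y => //; exists z.
Qed.

HB.instance Definition _ := isSemigroup.Build (phomeo X) phomeo_mulA.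

End PartialHomeomorphisms.

Section OverSpace.
Variables (X : topologicalType) (S : semigroupType) (rho : S -> phomeo X).

Definition representation := {morph rho : s t / s * t}.

(* A representation maps idempotents to idempotents and is multiplicative, so
   its restriction to idempotents is an isomorphism iff it is a bijection. *)
Definition full_representation :=
  representation /\ set_bij (@idempotents S) (@idempotents (phomeo X)) rho.

Definition complete_inverse_semigroup_over :=
  complete_inverse_semigroup S /\ full_representation.

End OverSpace.

(* [gmul x y] is the product of [x] and [y] when [grange x = gdom y], and is
   unspecified otherwise; no axiom or definition uses the other values. *)
Record topological_groupoid (X : topologicalType) := TopologicalGroupoid {
  arrows :> topologicalType;
  gdom : arrows -> X;
  grange : arrows -> X;
  gunit : X -> arrows;
  ginv : arrows -> arrows;
  gmul : arrows -> arrows -> arrows;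
  gdom_continuous : continuous gdom;
  grange_continuous : continuous grange;
  gunit_continuous : continuous gunit;
  ginv_continuous : continuous ginv;
  gmul_continuous : {within [set p : arrows * arrows | grange p.1 = gdom p.2],
    continuous (fun p : arrows * arrows => gmul p.1 p.2)};
  gdom_unit : forall x, gdom (gunit x) = x;
  grange_unit : forall x, grange (gunit x) = x;
  gdom_inv : forall a, gdom (ginv a) = grange a;
  grange_inv : forall a, grange (ginv a) = gdom a;
  gdom_mul : forall a b, grange a = gdom b -> gdom (gmul a b) = gdom a;
  grange_mul : forall a b, grange a = gdom b -> grange (gmul a b) = grange b;
  gmulA : forall a b c, grange a = gdom b -> grange b = gdom c ->
    gmul a (gmul b c) = gmul (gmul a b) c;
  gmul1l : forall a, gmul (gunit (gdom a)) a = a;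
  gmul1r : forall a, gmul a (gunit (grange a)) = a;
  gmulV : forall a, gmul a (ginv a) = gunit (gdom a);
  gmulVl : forall a, gmul (ginv a) a = gunit (grange a)
}.

Record etale_groupoid (X : topologicalType) := EtaleGroupoid {
  groupoid :> topological_groupoid X;
  etale : local_homeomorphism (@gdom X groupoid)
}.

Definition is_bisection (X : topologicalType) (G : topological_groupoid X)
    (V : set G) :=
  [/\ open V, set_inj V (@gdom X G) & set_inj V (@grange X G)].

Section EtaleFacts.
Variables (X : topologicalType) (G : etale_groupoid X).
Implicit Types V W : set G.

Lemma gdom_open V : open V -> open (@gdom X G @` V).
Proof.
move=> oV; rewrite openE => _ [a Va <-].
have [A [oA Aa odA [g [[_ gA] gK dK _ cg]]]] := @etale _ G a.
have oU : open ((@gdom X G @` A) `&` g @^-1` V).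
  by rewrite continuous_open_subspace// in cg; move/continuous_inP: cg; apply.
rewrite /interior nbhsE; exists ((@gdom X G @` A) `&` g @^-1` V).
  by split=> //; split; [exists a|rewrite /= gK ?inE].
move=> x [dAx Vgx]; exists (g x) => //.
by rewrite dK ?inE.
Qed.

Lemma gdom_homeomorphism V : is_bisection V -> V !=set0 ->
  homeomorphism_on V (@gdom X G @` V) (@gdom X G).
Proof.
move=> [oV dV _] [a0 Va0].
pose g x := xget a0 [set a | V a /\ gdom a = x].
have gP x : (@gdom X G @` V) x -> V (g x) /\ gdom (g x) = x.
  by move=> [a Va ax]; rewrite /g; case: xgetP => // /(_ a) [].
have gK : {in V, cancel (@gdom X G) g}.
  move=> a /[!inE] Va; have [|Vg dg] := gP (gdom a); first by exists a.
  by apply: dV; rewrite ?inE.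
exists g; split=> //.
- by split=> [a Va|x /gP[]//]; exists a.
- by move=> x /[!inE] /gP[].
- by apply: continuous_subspaceT; exact: gdom_continuous.
- rewrite continuous_open_subspace; last exact: gdom_open.
  apply/continuous_inP; first exact: gdom_open.
  move=> W oW; rewrite (_ : _ `&` _ = @gdom X G @` (V `&` W)).
    exact/gdom_open/openI.
  apply/seteqP; split=> [x [/gP[Vg dg] Wg]|_ [a [Va Wa] <-]].
    by exists (g x).
  by split; [exists a|rewrite /= gK ?inE].
Qed.

Lemma ginvK : involutive (@ginv X G).
Proof.
move=> a; rewrite -[LHS]gmul1r grange_inv gdom_inv -gmulVl.
rewrite gmulA ?grange_inv// gmulVl grange_inv.
exact: gmul1l.
Qed.

Lemma is_bisection_inv V : is_bisection V -> is_bisection (@ginv X G @^-1` V).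
Proof.
move=> [oV dV rV]; split.
- by apply: open_comp => // a _; exact: ginv_continuous.
- move=> a b /[!inE] /= Va Vb ab; apply: (can_inj ginvK).
  by apply: rV; rewrite ?inE// !grange_inv.
- move=> a b /[!inE] /= Va Vb ab; apply: (can_inj ginvK).
  by apply: dV; rewrite ?inE// !gdom_inv.
Qed.

Lemma grange_homeomorphism V : is_bisection V -> V !=set0 ->
  open (@grange X G @` V) /\
  homeomorphism_on V (@grange X G @` V) (@grange X G).
Proof.
move=> Vb [a0 Va0].
have imE : @grange X G @` V = @gdom X G @` (@ginv X G @^-1` V).
  apply/seteqP; split=> _ [a Va <-]; exists (ginv a).
  - by rewrite /= ginvK.
  - exact: gdom_inv.
  - by [].
  - exact: grange_inv.
have orV : open (@grange X G @` V).
  by rewrite imE; apply: gdom_open; have [] := is_bisection_inv Vb.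
split=> //; have [oV dV rV] := Vb.
have [|g [[_ gV] _ dK _ cg]] := gdom_homeomorphism (is_bisection_inv Vb).
  by exists (ginv a0); rewrite /= ginvK.
rewrite -imE in gV dK cg.
exists (@ginv X G \o g); split.
- by split=> [a Va|x /gV//]; exists a.
- move=> a /[!inE] Va; have rVa : (@grange X G @` V) (grange a) by exists a.
  apply: rV; rewrite ?inE//; first exact: gV.
  by rewrite /= grange_inv dK ?inE.
- by move=> x xV; rewrite /= grange_inv dK.
- by apply: continuous_subspaceT; exact: grange_continuous.
- move=> x; apply: (@continuous_comp (subspace _) _ _ g (@ginv X G)).
    exact: cg.
  exact: ginv_continuous.
Qed.

Lemma is_bisection_mul V W : is_bisection V -> is_bisection W ->
  is_bisection [set c | exists a b,
    [/\ V a, W b, grange a = gdom b & c = gmul a b]].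
Proof.
move=> Vb [oW dW rW]; have [oV dV rV] := Vb; split; last first.
- move=> _ _ /[!inE] -[a [b [Va Wb ab ->]]] [a' [b' [Va' Wb' ab' ->]]].
  rewrite !grange_mul// => bb'.
  have {bb'}bE : b = b' by apply: rW; rewrite ?inE.
  by subst b'; congr gmul; apply: rV; rewrite ?inE// ab'.
- move=> _ _ /[!inE] -[a [b [Va Wb ab ->]]] [a' [b' [Va' Wb' ab' ->]]].
  rewrite !gdom_mul// => aa'.
  have {aa'}aE : a = a' by apply: dV; rewrite ?inE.
  by subst a'; congr gmul; apply: dW; rewrite ?inE// -ab.
have [V0|] := pselect (V !=set0); last first.
  move=> V0; rewrite (_ : mkset _ = set0); first exact: open0.
  by apply/seteqP; split=> // c [a [b [Va]]]; case: V0; exists a.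
have [g [[_ gV] gK dK _ cg]] := gdom_homeomorphism Vb V0.
have odV := gdom_open oV.
rewrite continuous_open_subspace// in cg.
pose O := @gdom X G @^-1` (@gdom X G @` V).
have oO : open O by apply: open_comp => // a _; exact: gdom_continuous.
pose h (c : G) : G * G := (ginv (g (gdom c)), c).
have hP c : O c -> grange (h c).1 = gdom (h c).2.
  by move=> Oc; rewrite /= grange_inv dK ?inE.
rewrite (_ : mkset _ = O `&` (fun c => gmul (h c).1 (h c).2) @^-1` W).
  suff : {in O, continuous (fun c => gmul (h c).1 (h c).2)}.
    by move/continuous_inP; apply.
  move=> c /[!inE] Oc N /= Nc.
  have ch : h @ c --> h c.
    apply: cvg_pair; last exact: cvg_id.
    apply: (@continuous_comp _ _ _ (g \o @gdom X G) (@ginv X G)).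
      apply: continuous_comp; first exact: gdom_continuous.
      by apply: cg; rewrite inE.
    exact: ginv_continuous.
  have Nhc : within [set p : G * G | grange p.1 = gdom p.2] (nbhs (h c))
      ((fun p : G * G => gmul p.1 p.2) @^-1` N).
    rewrite nbhs_subspace_in; last exact: hP.
    exact: (@gmul_continuous X G (h c) N Nc).
  have nO : nbhs c O by exact: open_nbhs_nbhs.
  have nh : nbhs c (h @^-1` [set p | grange p.1 = gdom p.2 ->
      N (gmul p.1 p.2)]) by exact: ch _ Nhc.
  change (nbhs c (fun c' => N (gmul (h c').1 (h c').2))).
  apply: filterS (filterI nh nO) => c' [/= + Oc']; apply.
  exact: hP.
apply/seteqP; split=> [_ [a [b [Va Wb ab ->]]]|c [Oc Wc]].
  split; first by exists a => //; rewrite gdom_mul.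
  rewrite /= gdom_mul// gK ?inE// gmulA ?grange_inv ?gmulVl//.
  by rewrite ab gmul1l.
exists (g (gdom c)), (gmul (h c).1 (h c).2); split=> //.
- exact: gV.
- by rewrite gdom_mul ?hP//= gdom_inv.
- rewrite gmulA ?gdom_inv ?hP//= gmulV dK ?inE//.
  by rewrite gmul1l.
Qed.

Lemma is_phomeo_bisection V : is_bisection V ->
  is_phomeo [set (gdom a, grange a) | a in V].
Proof.
move=> Vb; have [oV dV rV] := Vb.
have [V0|V0] := pselect (V !=set0); last first.
  have -> : V = set0 by apply/seteqP; split=> // a Va; case: V0; exists a.
  exists set0, set0, id; rewrite !image_set0; split=> //; try exact: open0.
  exists id; split=> //; first by split.
  - by apply: continuous_subspaceT => ?; exact: cvg_id.
  - by apply: continuous_subspaceT => ?; exact: cvg_id.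
have odV := gdom_open oV.
have [g [[dg gV] gK dK cd cg]] := gdom_homeomorphism Vb V0.
have [orV [k [[rk kV] kK rK cr ck]]] := grange_homeomorphism Vb V0.
exists (@gdom X G @` V), (@grange X G @` V), (@grange X G \o g); split=> //.
- exists (@gdom X G \o k); split.
  + by split=> x xV; [exact/rk/gV|exact/dg/kV].
  + by move=> x /[!inE] xV; rewrite /= kK ?inE ?dK ?inE//; exact: gV.
  + by move=> x /[!inE] xV; rewrite /= gK ?inE ?rK ?inE//; exact: kV.
  + move=> x; apply: (@continuous_comp (subspace _) _ _ g (@grange X G)).
      exact: cg.
    exact: grange_continuous.
  + move=> x; apply: (@continuous_comp (subspace _) _ _ k (@gdom X G)).
      exact: ck.
    exact: gdom_continuous.
- apply/seteqP; split=> [_ [a Va <-]|_ [_ [a Va <-] <-]].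
    by exists (gdom a); [exists a|rewrite /= gK ?inE].
  by exists a => //=; rewrite gK ?inE.
Qed.

End EtaleFacts.

Record bisection (X : topologicalType) (G : etale_groupoid X) := Bisection {
  bisection_set :> set G;
  bisectionP : is_bisection bisection_set
}.

Section Bisections.
Variables (X : topologicalType) (G : etale_groupoid X).

Lemma bisection_eq (V W : bisection G) :
  bisection_set V = bisection_set W -> V = W.
Proof.
case: V W => [V VP] [W WP] /= VW.
by case: _ / VW in WP *; congr Bisection; apply: Prop_irrelevance.
Qed.

HB.instance Definition _ := gen_eqMixin (bisection G).
HB.instance Definition _ := gen_choiceMixin (bisection G).

Definition bisection_mul (V W : bisection G) : bisection G :=
  Bisection (is_bisection_mul (bisectionP V) (bisectionP W)).

Lemma bisection_mulA : associative bisection_mul.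
Proof.
move=> U V W; apply: bisection_eq; apply/seteqP; split=> x /=.
  move=> [a [_ [Ua [b [c [Vb Wc bc ->]]] + ->]]].
  rewrite gdom_mul// => ab; exists (gmul a b), c; split=> //.
  - by exists a, b.
  - by rewrite grange_mul.
  - exact: gmulA.
move=> [_ [c [[a [b [Ua Vb ab ->]]] Wc + ->]]].
rewrite grange_mul// => bc; exists a, (gmul b c); split=> //.
- by exists b, c.
- by rewrite gdom_mul.
- by rewrite gmulA.
Qed.

HB.instance Definition _ := isSemigroup.Build (bisection G) bisection_mulA.

Definition bisection_phomeo (V : bisection G) : phomeo X :=
  PHomeo (is_phomeo_bisection (bisectionP V)).

End Bisections.

Arguments bisection_phomeo {X} G V.

(* Main.v *)
Require Import Defs.
From HB Require Import structures.
From mathcomp Require Import all_boot monoid.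
From mathcomp Require Import boolp classical_sets functions topology.

Set Implicit Arguments.
Unset Strict Implicit.
Unset Printing Implicit Defensive.

Local Open Scope classical_set_scope.
Local Open Scope group_scope.

(** Why the correspondence holds.

    From groupoids to semigroups.  Multiplying open bisections pointwise makes
    every bisection V invertible in the sense of semigroups: the pointwise
    inverse of V is the only inverse, because W = W V W forces each arrow w of
    W to be w v w for an arrow v of V, hence w is the inverse of v.  An
    idempotent bisection consists of units, so the natural order is inclusion,
    and compatibility of V and W says that their union is still injective under
    domain and range.  Joins of compatible families are therefore unions.  The
    representation is full because the units of an etale groupoid form an open
    set homeomorphic to X: idempotent bisections are the sets u(U), U open in X.

    From semigroups to groupoids.  An arrow is the germ of some s in S at a
    point x of the domain of rho(s), where s and t have the same germ at x when
    e s = e t for an idempotent e whose image under rho is the identity of a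
    neighbourhood of x.  Fullness provides one idempotent for each open set,
    hence the possibility to restrict elements of S to open sets.  Calculus
    with idempotents (they commute, and s f = g s where g is the idempotent
    s f s*, the transport of f along s) shows that product and inverse of germs
    do not depend on representatives.  A set of germs is open when, with the
    germ of s at x, it contains the germs of s at the points near x; then the
    source map is a homeomorphism from the set V(s) of the germs of s onto the
    domain of rho(s), so the groupoid is etale.

    The map s |-> V(s) is multiplicative and recovers rho by construction.
    Completeness gives the rest.  Injectivity [germ_bisection_inj]: if V(s) is
    contained in V(t), the restrictions e s with e s = e t are compatible, and
    their join lies below t and equals s because it is a restriction of s with
    the same domain.  Surjectivity [germ_bisection_surj]: a bisection V is
    covered by the V(s) that it contains; these s are compatible, and V(j) = V
    for their join j, whose domain cannot exceed that of V because j can be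
    restricted to it and remain an upper bound. *)

(** * Inverse semigroups: involution and commuting idempotents *)

Section InverseSemigroupTheory.
Variable S : semigroupType.
Implicit Types s t e f : S.
Hypothesis invS : inverse_semigroup S.

Lemma starP s : is_inverse s (star s).
Proof.
have [t [st _]] := invS s.
by rewrite /star; case: xgetP => [//|/(_ t)].
Qed.

Lemma star_unique s t : is_inverse s t -> star s = t.
Proof.
by have [u [_ uE]] := invS s; move=> /uE <-; rewrite (uE _ (starP s)).
Qed.

Lemma mul_starK s : s * star s * s = s.
Proof. by have [] := starP s. Qed.

Lemma star_mulK s : star s * s * star s = star s.
Proof. by have [] := starP s. Qed.

Lemma starK s : star (star s) = s.
Proof. by apply: star_unique; have [] := starP s. Qed.

Lemma star_idempotent e : idempotents e -> star e = e.
Proof. by move=> ee; apply: star_unique; split; rewrite !ee. Qed.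

Lemma mul_star_idempotent s : idempotents (s * star s).
Proof. by rewrite /idempotents /= mulgA mul_starK. Qed.

Lemma star_mul_idempotent s : idempotents (star s * s).
Proof. by rewrite /idempotents /= mulgA star_mulK. Qed.

Lemma idempotentK e s : idempotents e -> s * e * e = s * e.
Proof. by move=> ee; rewrite -mulgA ee. Qed.

(** With x the inverse of e f, the element f x e is another inverse of e f, so
    x = f x e; this makes x idempotent, hence its own inverse, hence equal to
    e f. *)
Lemma mul_idempotent e f : idempotents e -> idempotents f ->
  idempotents (e * f).
Proof.
move=> ee ff; set x := star (e * f).
have [efx xef] : is_inverse (e * f) x := starP _.
have xE : f * x * e = x.
  apply/esym/star_unique; split; rewrite !mulgA.
    rewrite (idempotentK _ ff) (idempotentK _ ee).
    by move: efx; rewrite !mulgA.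
  rewrite (idempotentK _ ee) (idempotentK _ ff).
  by move: (congr1 (fun y => f * y * e) xef); rewrite !mulgA.
have xx : idempotents x.
  rewrite /idempotents /= -{1}xE -{2}xE !mulgA -[RHS]xE.
  by move: (congr1 (fun y => f * y * e) xef); rewrite !mulgA.
suff <- : x = e * f by [].
by rewrite -(star_idempotent xx) /x starK.
Qed.

(** Both f e and the idempotent e f are inverses of e f. *)
Lemma idempotentC e f : idempotents e -> idempotents f -> e * f = f * e.
Proof.
move=> ee ff; rewrite -[LHS](star_idempotent (mul_idempotent ee ff)).
apply: star_unique; split; rewrite !mulgA.
  rewrite (idempotentK _ ff) (idempotentK _ ee) -mulgA.
  exact: mul_idempotent ee ff.
rewrite (idempotentK _ ee) (idempotentK _ ff) -mulgA.
exact: mul_idempotent ff ee.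
Qed.

Lemma starM s t : star (s * t) = star t * star s.
Proof.
have tC : star s * s * (t * star t) = t * star t * (star s * s).
  apply: idempotentC; first exact: star_mul_idempotent.
  exact: mul_star_idempotent.
apply: star_unique; split.
  transitivity (s * (t * star t * (star s * s)) * t); first by rewrite !mulgA.
  by rewrite -tC !mulgA mul_starK -!mulgA [t * _]mulgA mul_starK.
transitivity (star t * (star s * s * (t * star t)) * star s).
  by rewrite !mulgA.
by rewrite tC !mulgA star_mulK -!mulgA [star s * _]mulgA star_mulK.
Qed.

(** Moves an idempotent across s, from the right to the left; pointwise, a
    restriction of the range of s is a restriction of its domain to the
    preimage. *)
Lemma conj_idempotentE s f : idempotents f -> s * f = s * f * star s * s.
Proof.
move=> ff; rewrite -[in LHS](mul_starK s) -!mulgA; congr (_ * _).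
by rewrite mulgA idempotentC//; exact: star_mul_idempotent.
Qed.

Lemma conj_idempotent s f : idempotents f -> idempotents (s * f * star s).
Proof.
by move=> ff; rewrite /idempotents /= !mulgA -conj_idempotentE// idempotentK.
Qed.

Lemma natural_le_anti s t : natural_le s t -> natural_le t s -> s = t.
Proof.
move=> [e ee est] [f ff tfs]; rewrite tfs {1}est {1}tfs mulgA.
rewrite (idempotentC ee ff) -mulgA.
have : e * s = s by rewrite {1}est mulgA ee.
by move=> ->.
Qed.

End InverseSemigroupTheory.

(** * The inverse semigroup of open bisections *)

Section BisectionSemigroup.
Variables (X : topologicalType) (G : etale_groupoid X).
Implicit Types (a b c : G) (V W : bisection G).

Definition bisection_inv V : bisection G :=
  Bisection (is_bisection_inv (bisectionP V)).

Lemma bisection_invK : involutive bisection_inv.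
Proof.
by move=> V; apply: bisection_eq; apply/seteqP; split=> a /=; rewrite ginvK.
Qed.

Lemma gdom_inj V a b : bisection_set V a -> bisection_set V b ->
  gdom a = gdom b -> a = b.
Proof. by case: (bisectionP V) => _ Vd _ Va Vb; apply: Vd; rewrite inE. Qed.

Lemma grange_inj V a b : bisection_set V a -> bisection_set V b ->
  grange a = grange b -> a = b.
Proof. by case: (bisectionP V) => _ _ Vr Va Vb; apply: Vr; rewrite inE. Qed.

Lemma gmulKl a b : grange a = gdom b -> gmul (ginv a) (gmul a b) = b.
Proof. by move=> ab; rewrite gmulA ?grange_inv// gmulVl ab gmul1l. Qed.

Lemma gmulKr a b : grange a = gdom b -> gmul (gmul a b) (ginv b) = a.
Proof. by move=> ab; rewrite -gmulA ?gdom_inv// gmulV -ab gmul1r. Qed.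

Lemma bisection_mul_invK V : V * bisection_inv V * V = V.
Proof.
apply: bisection_eq; apply/seteqP; split.
  move=> _ [_ [c [[a [b [Va Vb ab ->]]] Vc + ->]]].
  rewrite grange_mul// => bc.
  have ba : ginv b = a.
    by apply: (grange_inj (V := V)) => //; rewrite grange_inv.
  have ca : c = a by apply: gdom_inj Vc Va _; rewrite -ba gdom_inv.
  by rewrite ca -[b]ginvK ba gmulV gmul1l.
move=> a Va; exists (gmul a (ginv a)), a; split=> //.
- by exists a, (ginv a); split=> //=; rewrite ?ginvK ?gdom_inv.
- by rewrite grange_mul ?gdom_inv ?grange_inv.
- by rewrite gmulV gmul1l.
Qed.

Lemma is_inverse_bisection_inv V : is_inverse V (bisection_inv V).
Proof.
split; first exact: bisection_mul_invK.
by rewrite -{2}[V]bisection_invK bisection_mul_invK.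
Qed.

(** Write a = (b d) c with b, c in W and d in V.  Comparing domains and ranges
    gives b = a = c, so a = a d a and d is the inverse of a. *)
Lemma is_inverse_sub V W a : is_inverse V W -> bisection_set W a ->
  bisection_set V (ginv a).
Proof.
move=> [_ WVW] Wa; have := Wa; rewrite -[in bisection_set W a]WVW.
move=> [_ [c [[b [d [Wb Vd bd ->]]] Wc + aE]]].
rewrite grange_mul// => dc.
have bdc : grange (gmul b d) = gdom c by rewrite grange_mul.
have ab : a = b by apply: gdom_inj Wa Wb _; rewrite aE !gdom_mul.
have ac : a = c by apply: grange_inj Wa Wc _; rewrite aE grange_mul.
subst b c; suff -> : ginv a = d by [].
have ad : gmul a d = gunit G (gdom a) by rewrite -(gmulKr bdc) -aE gmulV.
by rewrite -(gmulKl bd) ad -grange_inv gmul1r.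
Qed.

Lemma bisection_inverse_semigroup : inverse_semigroup (bisection G).
Proof.
move=> V; exists (bisection_inv V); split; 
  first exact: is_inverse_bisection_inv.
move=> W VW; apply: bisection_eq; apply/seteqP; split=> a /=.
  move=> Va; rewrite -[a]ginvK; apply: is_inverse_sub Va.
  by case: VW.
exact: is_inverse_sub.
Qed.

Lemma star_bisection V : star V = bisection_inv V.
Proof.
apply: (star_unique bisection_inverse_semigroup).
exact: is_inverse_bisection_inv.
Qed.

Lemma gmul_idem a : grange a = gdom a -> gmul a a = a -> a = gunit G (gdom a).
Proof.
move=> ra aa; rewrite -{1}[a]gmul1l -ra -gmulVl -gmulA ?grange_inv// aa.
by rewrite gmulVl.
Qed.

(** If V V = V, then an arrow a = b c of V has the domain of b and the range of
    c, so a = b = c and a a = a. *)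
Lemma idempotent_bisectionP V :
  idempotents V <-> forall a, bisection_set V a -> a = gunit G (gdom a).
Proof.
split=> [VV a Va|Vu].
  have := Va; rewrite -{1}VV => -[b [c [Vb Vc bc aE]]].
  have ab : a = b by apply: gdom_inj Va Vb _; rewrite aE gdom_mul.
  have ac : a = c by apply: grange_inj Va Vc _; rewrite aE grange_mul.
  by subst b c; apply: gmul_idem.
have ra a : bisection_set V a -> grange a = gdom a.
  by move=> /Vu {1}->; rewrite grange_unit.
apply: bisection_eq; apply/seteqP; split=> [_ [a [b [Va Vb ab ->]]]|a Va].
  by rewrite [X in gmul X _](Vu a Va) -ra// ab gmul1l.
by exists a, a; rewrite ra// [X in gmul X _](Vu a Va) gmul1l.
Qed.

(** When V is contained in W, the idempotent that cuts V out of W is V V^-1; its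
    openness comes with the product of bisections. *)
Lemma natural_le_bisectionP V W :
  natural_le V W <-> bisection_set V `<=` bisection_set W.
Proof.
split=> [[F /idempotent_bisectionP Fu ->] _ [a [b [Fa Wb ab ->]]]|VW].
  by move: ab; rewrite (Fu a Fa) grange_unit => ->; rewrite gmul1l.
exists (V * bisection_inv V).
  rewrite -star_bisection.
  exact: (mul_star_idempotent bisection_inverse_semigroup).
apply: bisection_eq; apply/seteqP; split.
  move=> a Va; exists (gmul a (ginv a)), a; split=> //.
  - by exists a, (ginv a); rewrite /= ginvK gdom_inv.
  - exact: VW.
  - by rewrite grange_mul ?grange_inv ?gdom_inv.
  - by rewrite gmulV gmul1l.
move=> _ [_ [c [[a [b [Va Vb ab ->]]] Wc + ->]]].
rewrite grange_mul// => bc.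
have ba : ginv b = a.
  by apply: (grange_inj (V := V)) => //; rewrite grange_inv.
have ca : c = a by apply: gdom_inj Wc (VW _ Va) _; rewrite -ba gdom_inv.
by rewrite ca -[b]ginvK ba gmulV gmul1l.
Qed.

(** The product a^-1 b is defined and lies in V^-1 W, which consists of
    units. *)
Lemma compatible_gdom_inj V W a b : compatible V W ->
  bisection_set V a -> bisection_set W b -> gdom a = gdom b -> a = b.
Proof.
move=> [_]; rewrite star_bisection => /idempotent_bisectionP VWu Va Wb ab.
have dab : grange (ginv a) = gdom b by rewrite grange_inv.
have : bisection_set (bisection_inv V * W) (gmul (ginv a) b).
  by exists (ginv a), b; rewrite /= ginvK.
move=> /VWu; rewrite gdom_mul// gdom_inv => abu.
by rewrite -(gmulKl dab) ginvK abu gmul1r.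
Qed.

Lemma compatible_grange_inj V W a b : compatible V W ->
  bisection_set V a -> bisection_set W b -> grange a = grange b -> a = b.
Proof.
move=> [+ _]; rewrite star_bisection => /idempotent_bisectionP VWu Va Wb ab.
have rab : grange a = gdom (ginv b) by rewrite gdom_inv.
have : bisection_set (V * bisection_inv W) (gmul a (ginv b)).
  by exists a, (ginv b); rewrite /= ginvK.
move=> /VWu; rewrite gdom_mul// => abu.
rewrite -(gmulKr rab) abu ginvK.
have -> : gdom a = gdom b.
  by rewrite -[LHS](@grange_unit _ G) -abu grange_mul// grange_inv.
by rewrite gmul1l.
Qed.

(** Inside one bisection U, an arrow a and an inverse b^-1 of an arrow of U are
    composable only if a = b; so V W^-1 and V^-1 W consist of units. *)
Lemma compatible_sub V W (U : bisection G) :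
  bisection_set V `<=` bisection_set U ->
  bisection_set W `<=` bisection_set U ->
  compatible V W.
Proof.
move=> VU WU; split; rewrite star_bisection; apply/idempotent_bisectionP.
  move=> _ [a [b [Va /WU Ub ab ->]]].
  have ba : ginv b = a.
    by apply: grange_inj Ub (VU _ Va) _; rewrite grange_inv.
  by rewrite -[b]ginvK ba gmulV gdom_unit.
move=> _ [b [a [/VU Ub Wa ba ->]]].
have ab : ginv b = a by apply: gdom_inj Ub (WU _ Wa) _; rewrite gdom_inv.
by rewrite -ab gmulV gdom_unit.
Qed.

Lemma is_bisection_bigcup (A : set (bisection G)) : compatible_set A ->
  is_bisection (\bigcup_(V in A) bisection_set V).
Proof.
move=> Ac; split.
- by apply: bigcup_open => V _; have [] := bisectionP V.
- move=> a b /[!inE] -[V AV Va] [W AW Wb].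
  exact: compatible_gdom_inj (Ac _ _ AV AW) Va Wb.
- move=> a b /[!inE] -[V AV Va] [W AW Wb].
  exact: compatible_grange_inj (Ac _ _ AV AW) Va Wb.
Qed.

Lemma bisection_complete_inverse_semigroup :
  complete_inverse_semigroup (bisection G).
Proof.
split=> [|A Ac]; first exact: bisection_inverse_semigroup.
exists (Bisection (is_bisection_bigcup Ac)); split=> V.
  by move=> AV; apply/natural_le_bisectionP => a Va; exists V.
move=> AV; apply/natural_le_bisectionP => a [W AW Wa].
by have /natural_le_bisectionP := AV _ AW; apply.
Qed.

Lemma bisection_phomeo_representation : representation (bisection_phomeo G).
Proof.
move=> V W; apply: phomeo_eq; apply/seteqP; split=> /=.
  move=> _ [_ [a [b [Va Wb ab ->]]] <-] /=; exists (grange a).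
    by exists a => //; rewrite gdom_mul.
  by exists b => //; rewrite ab grange_mul.
move=> [x z] /= [y [a Va [<- <-]] [b Wb [ba <-]]].
exists (gmul a b); last by rewrite gdom_mul// grange_mul.
by exists a, b.
Qed.

(** The unit map is a section of gdom.  Near a unit, gdom is injective on an
    open set A; an arrow a of A whose unit u(gdom a) is also in A must be equal
    to this unit. *)
Lemma gunit_open (U : set X) : open U -> open (gunit G @` U).
Proof.
move=> oU; rewrite openE => _ [x Ux <-].
have [A [oA Ax _ [g [_ gK _ _ _]]]] := @etale _ G (gunit G x).
pose O := U `&` gunit G @^-1` A.
have oO : open O.
  by apply: openI => //; apply: open_comp => // y _; exact: gunit_continuous.
rewrite /interior nbhsE; exists (A `&` @gdom X G @^-1` O).
  split; last by split=> //; split; rewrite /= gdom_unit.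
  by apply: openI => //; apply: open_comp => // a _; exact: gdom_continuous.
move=> a [Aa [Ua Aua]]; exists (gdom a) => //.
by rewrite -[LHS]gK ?inE// gdom_unit gK ?inE.
Qed.

Lemma is_bisection_gunit (U : set X) : open U -> is_bisection (gunit G @` U).
Proof.
move=> oU; split; first exact: gunit_open.
- by move=> _ _ /[!inE] -[x _ <-] [y _ <-]; rewrite !gdom_unit => ->.
- by move=> _ _ /[!inE] -[x _ <-] [y _ <-]; rewrite !grange_unit => ->.
Qed.

End BisectionSemigroup.

(** * Partial homeomorphisms and their idempotents *)

Section PartialHomeomorphismTheory.
Variable X : topologicalType.
Implicit Types (h k : phomeo X) (U : set X).

Lemma graph_fun h x y z : graph h (x, y) -> graph h (x, z) -> y = z.
Proof.
have [A [B [f [_ _ _ ->]]]] := graphP h.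
by move=> [a _ [<- <-]] [b _ [-> <-]].
Qed.

Lemma graph_inj h x y z : graph h (x, z) -> graph h (y, z) -> x = y.
Proof.
have [A [B [f [_ _ [g [_ fK _ _ _]] ->]]]] := graphP h.
move=> [a Aa [<- <-]] [b Ab [<- ab]].
by rewrite -[a]fK ?inE// -ab fK ?inE.
Qed.

(** Continuity and openness of the domain of h in one statement. *)
Lemma graph_near h x y (P : set X) : graph h (x, y) -> nbhs y P ->
  \forall x' \near x, exists2 y', graph h (x', y') & P y'.
Proof.
have [A [B [f [oA _ [g [_ _ _ cf _]] ->]]]] := graphP h.
rewrite continuous_open_subspace// in cf.
move=> [a Aa [<- <-]] fP.
have nA : nbhs a A by exact: open_nbhs_nbhs.
have nP : nbhs a (f @^-1` P) by apply: cf => //; rewrite inE.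
apply: filterS (filterI nA nP) => x' [Ax' Px'].
by exists (f x') => //; exists x'.
Qed.

Lemma graph_dom_open h : open [set x | exists y, graph h (x, y)].
Proof.
rewrite openE => x [y hxy]; rewrite /interior.
by apply: filterS (graph_near hxy filterT) => x' [y' ? _]; exists y'.
Qed.

Lemma is_phomeo_id U : open U -> is_phomeo [set (x, x) | x in U].
Proof.
move=> oU; exists U, U, id; split=> //; exists id; split=> //; first by split.
- by apply: continuous_subspaceT => ?; exact: cvg_id.
- by apply: continuous_subspaceT => ?; exact: cvg_id.
Qed.

Definition phomeo_id U (oU : open U) : phomeo X := PHomeo (is_phomeo_id oU).

Lemma phomeo_id_idempotent U (oU : open U) : idempotents (phomeo_id oU).
Proof.
apply: phomeo_eq; apply/seteqP; split=> [[x z] /=|_ [x Ux <-]] /=.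
  by move=> [y [a Ua [<- <-]] [_ _ [-> <-]]]; exists a.
by exists x; exists x.
Qed.

Lemma graph_idempotent h x y : idempotents h -> graph h (x, y) -> x = y.
Proof.
move=> hh hxy; have := hxy; rewrite -{1}hh => -[z /= hxz hzy].
by move: hzy; rewrite (graph_fun hxz hxy); exact: graph_inj.
Qed.

Lemma idempotent_phomeo_id h : idempotents h ->
  h = phomeo_id (graph_dom_open h).
Proof.
move=> hh; apply: phomeo_eq; apply/seteqP; split=> [[x y]|_ [x [y] + <-]].
  by move=> /[dup] /(graph_idempotent hh) -> hyy; exists y => //; exists y.
by move=> /[dup] /(graph_idempotent hh) <-.
Qed.

Lemma mul_idempotent_graph h k x y : idempotents h ->
  graph (h * k) (x, y) <-> graph h (x, x) /\ graph k (x, y).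
Proof.
move=> hh; split=> [[z /= hxz kzy]|[hx kxy]]; last by exists x.
by move: (hxz) kzy; rewrite -(graph_idempotent hh hxz).
Qed.

End PartialHomeomorphismTheory.

Lemma bisections_complete_inverse_semigroup_over (X : topologicalType)
  (G : etale_groupoid X) : complete_inverse_semigroup_over (bisection_phomeo G).
Proof.
split; first exact: bisection_complete_inverse_semigroup.
split; first exact: bisection_phomeo_representation.
split.
- by move=> V VV; rewrite /idempotents /= -bisection_phomeo_representation VV.
- move=> V W /[!inE] /idempotent_bisectionP Vu /idempotent_bisectionP Wu.
  move=> /(congr1 (@graph X)) /= VW; apply: bisection_eq; apply/seteqP; split.
    move=> a Va; have : [set (gdom b, grange b) | b in bisection_set W]
      (gdom a, grange a) by rewrite -VW; exists a.
    by move=> [b Wb [ba _]]; rewrite (Vu a Va) -ba -(Wu b Wb).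
  move=> a Wa; have : [set (gdom b, grange b) | b in bisection_set V]
    (gdom a, grange a) by rewrite VW; exists a.
  by move=> [b Vb [ba _]]; rewrite (Wu a Wa) -ba -(Vu b Vb).
- move=> h hh; exists (Bisection (is_bisection_gunit G (graph_dom_open h))).
    by apply/idempotent_bisectionP => _ [x _ <-]; rewrite gdom_unit.
  rewrite [RHS](idempotent_phomeo_id hh); apply: phomeo_eq; apply/seteqP.
  split=> [_ [_ [x hx <-] <-]|_ [x hx <-]] /=.
    by exists x => //; rewrite gdom_unit grange_unit.
  by exists (gunit G x); [exists x|rewrite gdom_unit grange_unit].
Qed.

(** * Germs of a complete inverse semigroup over X *)

Section Germs.
Variables (X : topologicalType) (S : semigroupType) (rho : S -> phomeo X).
Implicit Types (x y z : X) (s t e f : S).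

Definition germ_eq x s t :=
  exists e, [/\ idempotents e, graph (rho e) (x, x) & e * s = e * t].

(** A germ is stored as its end points together with the set of all its
    representatives, so that no quotient is needed and equality of germs is
    equality of these data. *)
Record germ := Germ {
  source : X;
  target : X;
  reps : set S;
  germP : exists2 s, graph (rho s) (source, target) & reps = germ_eq source s
}.
Implicit Types a b c : germ.

Lemma germ_ext a b : source a = source b -> target a = target b ->
  reps a = reps b -> a = b.
Proof.
case: a b => [x y A AP] [x' y' B BP] /= xx' yy' AB; subst x' y' B.
by congr Germ; apply: Prop_irrelevance.
Qed.

HB.instance Definition _ := gen_eqMixin germ.
HB.instance Definition _ := gen_choiceMixin germ.

(** The sets of germs of a fixed s over open subsets of its domain form a basis
    of this topology. *)
Definition germ_open (W : set germ) := forall a s, W a -> reps a s ->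
  \forall x \near source a, forall b, reps b s -> source b = x -> W b.

Lemma germ_openT : germ_open setT.
Proof. by move=> a s _ _; apply: nearW. Qed.

Lemma germ_openI (V W : set germ) :
  germ_open V -> germ_open W -> germ_open (V `&` W).
Proof.
move=> oV oW a s [Va Wa] as_.
apply: filterS (filterI (oV a s Va as_) (oW a s Wa as_)) => x [xV xW] b bs bx.
by split; [exact: xV|exact: xW].
Qed.

Lemma germ_open_bigcup (I : Type) (W : I -> set germ) :
  (forall i, germ_open (W i)) -> germ_open (\bigcup_i W i).
Proof.
move=> oW a s [i _ Wa] as_; apply: filterS (oW i a s Wa as_) => x xW b bs bx.
by exists i => //; exact: xW.
Qed.

HB.instance Definition _ :=
  isOpenTopological.Build germ germ_openT germ_openI germ_open_bigcup.

Lemma open_germE (W : set germ) : open W = germ_open W.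
Proof. by []. Qed.

Hypothesis rhoS : complete_inverse_semigroup_over rho.

Lemma over_inverse_semigroup : inverse_semigroup S.
Proof. by case: rhoS => -[]. Qed.
Let invS := over_inverse_semigroup.

Lemma rho_mul s t : rho (s * t) = rho s * rho t.
Proof. by case: rhoS => _ [rhoM _]; exact: rhoM. Qed.

Lemma rho_idempotent e : idempotents e -> idempotents (rho e).
Proof. by move=> ee; rewrite /idempotents /= -rho_mul ee. Qed.

Lemma rho_idempotent_inj e f : idempotents e -> idempotents f ->
  rho e = rho f -> e = f.
Proof.
by case: rhoS => _ [_ [_ rho_inj _]] ee ff; apply: rho_inj; rewrite inE.
Qed.

(** Surjectivity of rho on idempotents, in the form in which it is used: S has
    restrictions to every open set. *)
Lemma open_idempotent (U : set X) : open U -> exists e, idempotents e /\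
  forall x, graph (rho e) (x, x) <-> U x.
Proof.
case: rhoS => _ [_ [_ _ rho_surj]] oU.
have [e ee eU] := rho_surj _ (phomeo_id_idempotent oU).
exists e; split=> // x; rewrite eU; split=> [[y Uy [<-]]//|Ux].
by exists x.
Qed.

Lemma graph_mul_idempotent e s x y : idempotents e ->
  graph (rho (e * s)) (x, y) <-> graph (rho e) (x, x) /\ graph (rho s) (x, y).
Proof.
move=> ee; rewrite rho_mul; apply: mul_idempotent_graph.
exact: rho_idempotent.
Qed.

Lemma graph_mul s t x z : graph (rho (s * t)) (x, z) <->
  exists2 y, graph (rho s) (x, y) & graph (rho t) (y, z).
Proof. by rewrite rho_mul. Qed.

Lemma graph_star s x y : graph (rho s) (x, y) -> graph (rho (star s)) (y, x).
Proof.
move=> /[dup] sxy; rewrite -{1}(mul_starK invS s).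
move=> /graph_mul[w /graph_mul[z sxz szw] swy].
by move: szw; rewrite (graph_fun sxz sxy) (graph_inj swy sxy).
Qed.

(** The order of the domains determines the order of idempotents, because rho is
    injective on idempotents. *)
Lemma idempotent_le e f : idempotents e -> idempotents f ->
  (forall x, graph (rho f) (x, x) -> graph (rho e) (x, x)) -> e * f = f.
Proof.
move=> ee ff fe; apply: rho_idempotent_inj => //.
  exact: (mul_idempotent invS).
apply: phomeo_eq; apply/seteqP; split=> -[x y].
  by move/(graph_mul_idempotent _ _ _ ee)=> [].
move=> fxy; apply/(graph_mul_idempotent _ _ _ ee); split=> //; apply: fe.
by rewrite {2}(graph_idempotent (rho_idempotent ff) fxy).
Qed.

Lemma idempotent_le_mul e s : idempotents e ->
  (forall x y, graph (rho s) (x, y) -> graph (rho e) (x, x)) -> e * s = s.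
Proof.
move=> ee se; rewrite -[in LHS](mul_starK invS s) mulgA.
rewrite (@idempotent_le e (s * star s))//.
- exact: mul_starK.
- exact: mul_star_idempotent.
- by move=> x /graph_mul[y /se].
Qed.

(** The identity of S; its germs are the units. *)
Definition full_idempotent : S := projT1 (cid (open_idempotent openT)).

Lemma full_idempotentP : idempotents full_idempotent.
Proof. by rewrite /full_idempotent; case: cid => e /= []. Qed.

Lemma graph_full_idempotent x : graph (rho full_idempotent) (x, x).
Proof. by rewrite /full_idempotent; case: cid => e /= [_ eT]; apply/eT. Qed.

Lemma germ_eq_refl x s : germ_eq x s s.
Proof.
exists full_idempotent; split=> //; first exact: full_idempotentP.
exact: graph_full_idempotent.
Qed.

Lemma germ_eq_sym x s t : germ_eq x s t -> germ_eq x t s.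
Proof. by move=> [e [ee ex est]]; exists e. Qed.

(** The product of the two idempotents is a witness, since they commute. *)
Lemma germ_eq_trans x s t u : germ_eq x s t -> germ_eq x t u -> germ_eq x s u.
Proof.
move=> [e [ee ex est]] [f [ff fx ftu]]; exists (f * e); split.
- exact: (mul_idempotent invS).
- exact/(graph_mul_idempotent _ _ _ ff).
- by rewrite -mulgA est mulgA (idempotentC invS ff ee) -mulgA ftu mulgA.
Qed.

Lemma germ_eq_graph x y s t :
  germ_eq x s t -> graph (rho s) (x, y) -> graph (rho t) (x, y).
Proof.
move=> [e [ee ex est]] sxy.
have : graph (rho (e * s)) (x, y) by apply/(graph_mul_idempotent _ _ _ ee).
by rewrite est => /(graph_mul_idempotent _ _ _ ee)[].
Qed.

Lemma germ_eq_restrl x e s : idempotents e -> graph (rho e) (x, x) ->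
  germ_eq x (e * s) s.
Proof. by move=> ee ex; exists e; rewrite mulgA ee. Qed.

(** Restricting the range of s around y does not change its germ at x: the
    restriction equals g s, where g = s f s* is an idempotent at x. *)
Lemma germ_eq_restrr x y s f : idempotents f -> graph (rho s) (x, y) ->
  graph (rho f) (y, y) -> germ_eq x (s * f) s.
Proof.
move=> ff sxy fy; exists (s * f * star s); split.
- exact: (conj_idempotent invS).
- apply/graph_mul; exists y; last exact: graph_star.
  by apply/graph_mul; exists y.
- by rewrite mulgA -(conj_idempotentE invS s ff) (idempotentK _ ff).
Qed.

(** If f t = f t' near y, then s t, (s f) t = (s f) t' and s t' have the same
    germ at x. *)
Lemma germ_eqM x y s s' t t' : germ_eq x s s' -> graph (rho s) (x, y) ->
  germ_eq y t t' -> germ_eq x (s * t) (s' * t').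
Proof.
have mulr u u' w : germ_eq x u u' -> germ_eq x (u * w) (u' * w).
  by move=> [e [ee ex euu']]; exists e; rewrite !mulgA euu'.
move=> ss' sxy [f [ff fy ftt']].
have sf := germ_eq_restrr ff sxy fy.
apply: (germ_eq_trans (mulr _ _ _ (germ_eq_sym sf))).
rewrite -mulgA ftt' mulgA; apply: mulr.
exact: germ_eq_trans ss'.
Qed.

(** If e s = e t, then s* e = t* e, and the idempotent s* e s, which is the
    transport of e to y, equalizes s* and t*. *)
Lemma germ_eq_star x y s t : germ_eq x s t -> graph (rho s) (x, y) ->
  germ_eq y (star s) (star t).
Proof.
move=> [e [ee ex est]] sxy; exists (star s * e * s).
have se : star s * e = star t * e.
  by rewrite -(star_idempotent invS ee) -!(starM invS) est.
split.
- by rewrite -{2}(starK invS s); exact: (conj_idempotent invS).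
- apply/graph_mul; exists x => //; apply/graph_mul; exists x => //.
  exact: graph_star.
- have cE u : star u * e * u * star u = star u * e.
    by rewrite [RHS](conj_idempotentE invS _ ee) (starK invS).
  by rewrite cE se -(mulgA _ e s) est mulgA cE.
Qed.

Lemma exists_rep a : exists s, reps a s.
Proof. by have [s _ ->] := germP a; exists s; exact: germ_eq_refl. Qed.

Lemma rep_graph a s : reps a s -> graph (rho s) (source a, target a).
Proof. by have [t tP ->] := germP a => /germ_eq_graph; exact. Qed.

Lemma rep_eq a s t : reps a s -> reps a t -> germ_eq (source a) s t.
Proof.
have [u _ ->] := germP a => us ut.
by apply: germ_eq_trans ut; exact: germ_eq_sym.
Qed.

Lemma rep_closed a s t : reps a s -> germ_eq (source a) s t -> reps a t.
Proof. by have [u _ ->] := germP a; exact: germ_eq_trans. Qed.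

Lemma germ_inj a b s : reps a s -> reps b s -> source a = source b -> a = b.
Proof.
move=> as_ bs ab; apply: germ_ext => //.
  by apply: graph_fun (rep_graph as_) _; rewrite ab; exact: rep_graph.
apply/seteqP; split=> t.
  by move/(rep_eq as_); rewrite ab; exact: rep_closed.
by move/(rep_eq bs); rewrite -ab; exact: rep_closed.
Qed.

Definition germ_at s x y (sxy : graph (rho s) (x, y)) : germ :=
  @Germ x y (germ_eq x s) (ex_intro2 _ _ s sxy erefl).

Lemma rep_germ_at s x y (sxy : graph (rho s) (x, y)) : reps (germ_at sxy) s.
Proof. exact: germ_eq_refl. Qed.

Lemma rep_mul_idempotent a e s : idempotents e ->
  reps a (e * s) <-> graph (rho e) (source a, source a) /\ reps a s.
Proof.
move=> ee; split=> [aes|[ea as_]].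
  have [ea _] := (graph_mul_idempotent _ _ _ ee).1 (rep_graph aes).
  by split=> //; apply: rep_closed aes _; exact: germ_eq_restrl.
by apply: rep_closed as_ _; apply: germ_eq_sym; exact: germ_eq_restrl.
Qed.

Lemma open_reps s : open [set a | reps a s].
Proof.
rewrite open_germE => a t /= as_ at_.
have [e [ee ea est]] := rep_eq at_ as_.
apply: filterS (graph_near ea filterT) => x [y exy _] b bt bx.
apply: rep_closed bt _; exists e; split=> //.
by rewrite bx {2}(graph_idempotent (rho_idempotent ee) exy).
Qed.

(** A neighbourhood of the germ of s at x contains the germs of s at the points
    near x; continuity of units, inverses and products reduces to this. *)
Lemma near_reps (W : set germ) a s : nbhs a W -> reps a s ->
  \forall x \near source a, forall b, reps b s -> source b = x -> W b.
Proof.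
rewrite nbhsE => -[V [oV Va] VW] as_.
rewrite open_germE in oV; apply: filterS (oV a s Va as_) => x xV b bs bx.
exact/VW/xV.
Qed.

Lemma source_continuous : continuous source.
Proof.
apply/continuousP => U oU; rewrite open_germE => a s Ua _.
by apply: filterS (open_nbhs_nbhs (conj oU Ua)) => x Ux b _ /= ->.
Qed.

Lemma target_continuous : continuous target.
Proof.
apply/continuousP => U oU; rewrite open_germE => a s Ua as_.
have := graph_near (rep_graph as_) (open_nbhs_nbhs (conj oU Ua)).
apply: filterS => x [y sxy Uy] b bs bx.
rewrite /= (_ : target b = y)//.
by apply: graph_fun (rep_graph bs) _; rewrite bx.
Qed.

(** * The etale groupoid of germs *)

Definition germ_unit x : germ := germ_at (graph_full_idempotent x).

(** Every idempotent at x represents the unit germ: any two idempotents e, f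
    agree after multiplication by e f. *)
Lemma rep_unit e x : idempotents e -> graph (rho e) (x, x) ->
  reps (germ_unit x) e.
Proof.
move=> ee ex; apply: rep_closed (rep_germ_at _) _ => /=.
exists (e * full_idempotent); split.
- exact: mul_idempotent full_idempotentP.
- apply/(graph_mul_idempotent _ _ _ ee); split=> //.
  exact: graph_full_idempotent.
- rewrite (idempotentK _ full_idempotentP).
  rewrite -(idempotentC invS full_idempotentP ee).
  by rewrite (idempotentK _ ee).
Qed.

Lemma germ_unit_continuous : continuous germ_unit.
Proof.
apply/continuousP => W oW; rewrite openE => x Wx; rewrite /interior.
have := near_reps (open_nbhs_nbhs (conj oW Wx)) (rep_germ_at _).
by apply: filterS => y; apply=> //; exact: rep_germ_at.
Qed.

(** The inverse and the product of germs are characterized by their values on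
    all representatives, which contains the independence of choices. *)
Lemma exists_germ_inv a : exists b, [/\ source b = target a,
  target b = source a & forall s, reps a s -> reps b (star s)].
Proof.
have [s as_] := exists_rep a.
exists (germ_at (graph_star (rep_graph as_))); split=> // t at_.
exact: germ_eq_star (rep_eq as_ at_) (rep_graph as_).
Qed.

Definition germ_inv a : germ := projT1 (cid (exists_germ_inv a)).

Lemma source_inv a : source (germ_inv a) = target a.
Proof. by rewrite /germ_inv; case: cid => b /= []. Qed.

Lemma target_inv a : target (germ_inv a) = source a.
Proof. by rewrite /germ_inv; case: cid => b /= []. Qed.

Lemma rep_inv a s : reps a s -> reps (germ_inv a) (star s).
Proof. by rewrite /germ_inv; case: cid => b /= [_ _]; exact. Qed.

Lemma germ_inv_continuous : continuous germ_inv.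
Proof.
apply/continuousP => W oW; rewrite open_germE => a s Wa as_.
have := near_reps (open_nbhs_nbhs (conj oW Wa)) (rep_inv as_).
rewrite source_inv => /(graph_near (rep_graph as_)).
apply: filterS => x [y sxy yW] b bs bx; apply: yW; first exact: rep_inv.
by rewrite source_inv; apply: graph_fun (rep_graph bs) _; rewrite bx.
Qed.

Lemma exists_germ_mul a b : exists c, target a = source b ->
  [/\ source c = source a, target c = target b &
      forall s t, reps a s -> reps b t -> reps c (s * t)].
Proof.
have [ab|] := pselect (target a = source b); last by exists a.
have [[s as_] [t bt]] := (exists_rep a, exists_rep b).
have st : graph (rho (s * t)) (source a, target b).
  apply/graph_mul; exists (target a); first exact: rep_graph.
  by rewrite ab; exact: rep_graph.
exists (germ_at st) => _; split=> // s' t' as' bt'.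
apply: germ_eqM (rep_eq as_ as') (rep_graph as_) _.
by rewrite ab; exact: rep_eq.
Qed.

Definition germ_mul a b : germ := projT1 (cid (exists_germ_mul a b)).

Lemma source_mul a b : target a = source b -> source (germ_mul a b) = source a.
Proof. by rewrite /germ_mul; case: cid => c /= cP /cP[]. Qed.

Lemma target_mul a b : target a = source b -> target (germ_mul a b) = target b.
Proof. by rewrite /germ_mul; case: cid => c /= cP /cP[]. Qed.

Lemma rep_mul a b s t : target a = source b -> reps a s -> reps b t ->
  reps (germ_mul a b) (s * t).
Proof. by rewrite /germ_mul; case: cid => c /= cP /cP[_ _]; exact. Qed.

(** Near ([s, x], [t, y]) it is enough to keep t and to restrict s to the points
    at which the germ of s t lies in the given neighbourhood of [s t, x]. *)
Lemma germ_mul_continuous :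
  {within [set p : germ * germ | target p.1 = source p.2],
    continuous (fun p : germ * germ => germ_mul p.1 p.2)}.
Proof.
apply/subspace_continuousP => -[a b] /= ab W /= abW.
have [[s as_] [t bt]] := (exists_rep a, exists_rep b).
have := near_reps abW (rep_mul ab as_ bt); rewrite source_mul// => aW.
exists ([set a' | reps a' s] `&` source @^-1` [set x | forall c,
    reps c (s * t) -> source c = x -> W c], [set b' | reps b' t]).
  split=> /=; last by apply: open_nbhs_nbhs; split=> //; exact: open_reps.
  apply: filterI; last exact: source_continuous aW.
  by apply: open_nbhs_nbhs; split=> //; exact: open_reps.
move=> [a' b'] /= [[a's xW] b't] ab'; apply: xW; first exact: rep_mul.
by rewrite source_mul.
Qed.

Lemma germ_mulA a b c : target a = source b -> target b = source c ->
  germ_mul a (germ_mul b c) = germ_mul (germ_mul a b) c.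
Proof.
move=> ab bc.
have [[s as_] [t bt]] := (exists_rep a, exists_rep b).
have [u cu] := exists_rep c.
have abc : target (germ_mul a b) = source c by rewrite target_mul.
have a_bc : target a = source (germ_mul b c) by rewrite source_mul.
apply: (@germ_inj _ _ (s * t * u)).
- by rewrite -mulgA; apply: rep_mul => //; exact: rep_mul.
- by apply: rep_mul => //; exact: rep_mul.
- by rewrite !source_mul.
Qed.

Lemma germ_mul1l a : germ_mul (germ_unit (source a)) a = a.
Proof.
have [s as_] := exists_rep a.
apply: (@germ_inj _ _ (full_idempotent * s)); last by rewrite source_mul.
- by apply: rep_mul => //; exact: rep_germ_at.
- apply/(rep_mul_idempotent _ _ full_idempotentP).
  by split=> //; exact: graph_full_idempotent.
Qed.

Lemma germ_mul1r a : germ_mul a (germ_unit (target a)) = a.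
Proof.
have [s as_] := exists_rep a.
apply: (@germ_inj _ _ (s * full_idempotent)); last by rewrite source_mul.
- by apply: rep_mul => //; exact: rep_germ_at.
- apply: (rep_closed as_); apply: germ_eq_sym.
  apply: germ_eq_restrr (rep_graph as_) _; first exact: full_idempotentP.
  exact: graph_full_idempotent.
Qed.

Lemma germ_mulV a : germ_mul a (germ_inv a) = germ_unit (source a).
Proof.
have [s as_] := exists_rep a.
have aV : target a = source (germ_inv a) by rewrite source_inv.
apply: (@germ_inj _ _ (s * star s)); last by rewrite source_mul.
- by apply: rep_mul => //; exact: rep_inv.
- apply: rep_unit; first exact: mul_star_idempotent.
  apply/graph_mul; exists (target a); first exact: rep_graph.
  exact/graph_star/rep_graph.
Qed.

Lemma germ_mulVl a : germ_mul (germ_inv a) a = germ_unit (target a).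
Proof.
have [s as_] := exists_rep a.
have aV : target (germ_inv a) = source a by rewrite target_inv.
apply: (@germ_inj _ _ (star s * s)); last by rewrite source_mul// source_inv.
- by apply: rep_mul => //; exact: rep_inv.
- apply: rep_unit; first exact: star_mul_idempotent.
  apply/graph_mul; exists (source a); last exact: rep_graph.
  exact/graph_star/rep_graph.
Qed.

Definition germ_topological_groupoid : topological_groupoid X :=
  TopologicalGroupoid source_continuous target_continuous germ_unit_continuous
    germ_inv_continuous germ_mul_continuous (fun=> erefl) (fun=> erefl)
    source_inv target_inv source_mul target_mul germ_mulA germ_mul1l germ_mul1r
    germ_mulV germ_mulVl.

(** On the germs of s, the inverse of the source map sends x to the germ of s
    at x. *)
Lemma source_local_homeomorphism : local_homeomorphism source.
Proof.
move=> a; have [s as_] := exists_rep a.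
have domE : source @` [set b | reps b s] =
    [set x | exists y, graph (rho s) (x, y)].
  apply/seteqP; split=> [_ [b bs <-]|x [y sxy]].
    by exists (target b); exact: rep_graph.
  by exists (germ_at sxy) => //; exact: rep_germ_at.
have odom : open (source @` [set b | reps b s]).
  by rewrite domE; exact: graph_dom_open.
exists [set b | reps b s]; split=> //; first exact: open_reps.
pose g x := xget a [set b | reps b s /\ source b = x].
have gP b : reps b s -> g (source b) = b.
  move=> bs; rewrite /g; case: xgetP => [c _ [cs cb]|/(_ b)[]//].
  exact: germ_inj cs bs cb.
exists g; split.
- by split=> [b bs|_ [b bs <-]]; [exists b|rewrite gP].
- by move=> b /[!inE] /gP.
- by move=> _ /[!inE] -[b bs <-]; rewrite gP.
- by apply: continuous_subspaceT; exact: source_continuous.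
- rewrite continuous_open_subspace//.
  move=> _ /[!inE] -[b bs <-] W; rewrite gP// => bW.
  have nd : nbhs (source b) (source @` [set b | reps b s]).
    by apply: open_nbhs_nbhs; split=> //; exists b.
  apply: filterS (filterI nd (near_reps bW bs)) => _ [[c cs <-] cW] /=.
  by rewrite gP//; exact: cW.
Qed.

Definition germ_groupoid : etale_groupoid X :=
  @EtaleGroupoid _ germ_topological_groupoid source_local_homeomorphism.

(** * The isomorphism onto the bisections of the groupoid of germs *)

Lemma is_bisection_reps s : @is_bisection X germ_groupoid [set a | reps a s].
Proof.
split; first exact: open_reps.
- by move=> a b /[!inE]; exact: germ_inj.
- move=> a b /[!inE] as_ bs ab; apply: (germ_inj as_ bs).
  by apply: graph_inj (rep_graph as_) _; move: ab => /= ->; exact: rep_graph.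
Qed.

Definition germ_bisection s : bisection germ_groupoid :=
  Bisection (is_bisection_reps s).

Lemma germ_bisectionM : {morph germ_bisection : s t / s * t}.
Proof.
move=> s t; apply: bisection_eq; apply/seteqP; split=> /=.
  move=> c /= cst; have := rep_graph cst => /graph_mul[y sxy tyz].
  exists (germ_at sxy), (germ_at tyz); split=> //; try exact: rep_germ_at.
  apply: germ_inj cst _ _; first by apply: rep_mul => //; exact: rep_germ_at.
  by rewrite source_mul.
by move=> _ [a [b [as_ bt ab ->]]]; exact: rep_mul.
Qed.

Lemma germ_bisection_phomeo s :
  bisection_phomeo germ_groupoid (germ_bisection s) = rho s.
Proof.
apply: phomeo_eq; apply/seteqP; split=> [_ [a as_ <-]|[x y] sxy].
  exact: rep_graph.
by exists (germ_at sxy) => //; exact: rep_germ_at.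
Qed.

(** The elements e s = e t, with e idempotent, form a compatible set.  Its join
    j is below t, and it is a restriction of s.  Since s and t have the same
    germ at every point of the domain of s, this restriction has full domain,
    so j = s. *)
Lemma germ_bisection_le s t :
  bisection_set (germ_bisection s) `<=` bisection_set (germ_bisection t) ->
  natural_le s t.
Proof.
move=> st.
pose A := [set u | exists e, [/\ idempotents e, u = e * s & e * s = e * t]].
have Ac : compatible_set A.
  move=> _ _ [e [ee -> _]] [f [ff -> _]].
  split; rewrite (starM invS).
    rewrite (star_idempotent invS ff) mulgA -(mulgA e).
    apply: (mul_idempotent invS) => //; apply: (mul_idempotent invS) => //.
    exact: mul_star_idempotent.
  rewrite (star_idempotent invS ee) mulgA -(mulgA (star s)).
  rewrite -{2}(starK invS s).
  by apply: (conj_idempotent invS); exact: (mul_idempotent invS).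
have [_ /(_ A Ac)[j [Aj jmin]]] := rhoS.1.
have jt : natural_le j t by apply: jmin => _ [e [ee -> ->]]; exists e.
suff <- : j = s by [].
have [g gg jgs] : natural_le j s by apply: jmin => _ [e [ee -> _]]; exists e.
rewrite jgs; apply: idempotent_le_mul => // x y sxy.
have [e [ee ex est]] : germ_eq x s t := st _ (rep_germ_at sxy).
have [h hh esj] : natural_le (e * s) j by apply: Aj; exists e.
have : graph (rho (e * s)) (x, y) by apply/(graph_mul_idempotent _ _ _ ee).
rewrite esj => /(graph_mul_idempotent _ _ _ hh)[_].
by rewrite jgs => /(graph_mul_idempotent _ _ _ gg)[].
Qed.

Lemma germ_bisection_inj : injective germ_bisection.
Proof.
move=> s t st.
by apply: (natural_le_anti invS); apply: germ_bisection_le; rewrite st.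
Qed.

Lemma germ_bisection_star s : germ_bisection (star s) = star (germ_bisection s).
Proof.
apply/esym; apply: (star_unique (@bisection_inverse_semigroup X germ_groupoid)).
by split; rewrite -!germ_bisectionM ?(mul_starK invS) ?(star_mulK invS).
Qed.

Lemma germ_bisection_idempotent s :
  idempotents (germ_bisection s) -> idempotents s.
Proof. by move=> ss; apply: germ_bisection_inj; rewrite germ_bisectionM. Qed.

Lemma germ_bisection_compatible s t :
  compatible (germ_bisection s) (germ_bisection t) -> compatible s t.
Proof.
rewrite /compatible -!germ_bisection_star -!germ_bisectionM => -[st ts].
by split; exact: germ_bisection_idempotent.
Qed.

Lemma germ_bisection_surj (V : bisection germ_groupoid) :
  exists s, germ_bisection s = V.
Proof.
pose A := [set s | bisection_set (germ_bisection s) `<=` bisection_set V].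
have Ac : compatible_set A.
  move=> s t sV tV; apply: germ_bisection_compatible.
  exact: compatible_sub sV tV.
have [_ /(_ A Ac)[j [Aj jmin]]] := rhoS.1.
have [oV _ _] := bisectionP V.
(* A germ a of V is also the germ of a restriction e s whose germs all lie in
   V. *)
have Vj : bisection_set V `<=` bisection_set (germ_bisection j).
  move=> a Va; have [s as_] := exists_rep a.
  have := near_reps (open_nbhs_nbhs (conj oV Va)) as_.
  rewrite /prop_near1 nbhsE => -[O [oO Oa] OV].
  have [e [ee eO]] := open_idempotent oO.
  have [h hh esj] : natural_le (e * s) j.
    by apply: Aj => b /(rep_mul_idempotent _ _ ee)[/eO/OV bV bs]; exact: bV.
  have : reps a (e * s).
    by apply/(rep_mul_idempotent _ _ ee); split=> //; exact/eO.
  by rewrite esj => /(rep_mul_idempotent _ _ hh)[].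
exists j; apply: bisection_eq; apply/seteqP; split=> // c cj.
(* Conversely, the restriction e j of j to the domain of V is still an upper
   bound, so j lies below it and c has the same source as some germ a of V;
   both are germs of j, hence equal. *)
have [e [ee eV]] := open_idempotent (gdom_open oV).
have [k kk jkej] : natural_le j (e * j).
  apply: jmin => u Au; have [h hh uj] := Aj _ Au; exists h => //.
  rewrite mulgA (idempotentC invS hh ee) -mulgA -uj.
  apply/esym/idempotent_le_mul => // x y uxy; apply/eV.
  by exists (germ_at uxy) => //; apply: Au; exact: rep_germ_at.
have : reps c (k * (e * j)) by rewrite -jkej.
move=> /(rep_mul_idempotent _ _ kk)[_].
move=> /(rep_mul_idempotent _ _ ee)[/eV [a Va ac] _].
by rewrite -(germ_inj (Vj _ Va) cj ac).
Qed.

Lemma germ_bisection_bij : bijective germ_bisection.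
Proof.
pose g V := projT1 (cid (germ_bisection_surj V)).
have gK : cancel g germ_bisection by move=> V; rewrite /g; case: cid.
by exists g => // s; apply: germ_bisection_inj; rewrite gK.
Qed.

End Germs.

Theorem theorem5p3 (X : topologicalType) :
  (forall G : etale_groupoid X,
     complete_inverse_semigroup_over (bisection_phomeo G)) /\
  (forall (S : semigroupType) (rho : S -> phomeo X),
     complete_inverse_semigroup_over rho ->
     exists (G : etale_groupoid X) (phi : S -> bisection G),
       [/\ {morph phi : s t / s * t}, bijective phi &
           forall s, bisection_phomeo G (phi s) = rho s]).
Proof.
split; first exact: bisections_complete_inverse_semigroup_over.
move=> S rho rhoS; exists (germ_groupoid rhoS), (germ_bisection rhoS); split.
- exact: germ_bisectionM.
- exact: germ_bisection_bij.
- exact: germ_bisection_phomeo.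
Qed.
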